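(* Let $n, m, d$ be positive integers with $m < n$. Then $P(n,d) \ge P(n,m,d)\cdot P(n-m,d)$.
   Context: For permutations $\sigma,\pi$ of $[1\ldots n]=\{1,\dots,n\}$ (written as strings $\sigma(1)\sigma(2)\cdots\sigma(n)$), the Kendall-$\tau$ distance $d(\sigma,\pi)$ is the minimum number of adjacent transpositions needed to transform $\sigma$ into $\pi$ (equivalently, the number of pairs of symbols appearing in different relative order in $\sigma$ and $\pi$). An $(n,d)$-PA is a set of permutations of $[1\ldots n]$ whose pairwise Kendall-$\tau$ distances are all at least $d$, and $P(n,d)$ is the maximum cardinality of an $(n,d)$-PA. For $m<n$, $S_{n,m}$ is the set of permutations of $[1\ldots n]$ in which the symbols $1,2,\dots,n-m$ appear in increasing order (left to right). An $(n,m,d)$-array is a subset of $S_{n,m}$ whose pairwise Kendall-$\tau$ distances are all at least $d$, and $P(n,m,d)$ is the maximum cardinality of an $(n,m,d)$-array. *)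

(* Defs.v *)
From HB Require Import structures.
From mathcomp Require Import all_boot all_fingroup.

Set Implicit Arguments.
Unset Strict Implicit.
Unset Printing Implicit Defensive.

Local Open Scope group_scope.

(* A permutation s : 'S_n encodes the string s 0, s 1, ..., s (n-1): it sends
   positions to symbols. Positions and symbols are both numbered from 0, so
   symbol k of [1..n] is the ordinal of value k - 1, and s^-1 a is the position
   of symbol a. *)

(* MathComp products apply the left factor first, so tperm i j * s is the
   string s with the entries at positions i and j exchanged. *)
Definition adj_swap n : rel 'S_n := fun s t =>
  [exists i : 'I_n, exists j : 'I_n,
     (nat_of_ord j == i.+1) && (t == tperm i j * s)].

Definition reach_in n (s t : 'S_n) (k : nat) : bool :=
  [exists p : k.-tuple 'S_n, path (@adj_swap n) s p && (last s p == t)].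

Definition adj_tperms n : {set 'S_n} :=
  [set u | [exists i : 'I_n, exists j : 'I_n,
              (nat_of_ord j == i.+1) && (u == tperm i j)]].

Lemma tperm_in_adj_gen n (i j : 'I_n) : tperm i j \in <<adj_tperms n>>.
Proof.
wlog le_ij : i j / i <= j.
  by move=> W; case/orP: (leq_total i j) => /W //; rewrite tpermC.
move: {2}(j - i)%N (leqnn (j - i)) => k.
elim: k j le_ij => [|k IHk] j le_ij.
  rewrite leqn0 subn_eq0 => le_ji.
  have -> : j = i by apply/val_inj/eqP; rewrite eqn_leq le_ji le_ij.
  by rewrite tperm1 group1.
move=> le_jik; move: le_ij; rewrite leq_eqVlt => /orP[/eqP/val_inj ->|lt_ij].
  by rewrite tperm1 group1.
have lt_j'n : j.-1 < n by apply: leq_ltn_trans (leq_pred _) (ltn_ord j).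
pose j' := Ordinal lt_j'n.
have jE : nat_of_ord j = j'.+1 by rewrite /= (ltn_predK lt_ij).
have le_ij' : i <= j' by rewrite -ltnS -jE.
have adjM : tperm j' j \in <<adj_tperms n>>.
  apply: mem_gen; rewrite inE; apply/existsP; exists j'.
  by apply/existsP; exists j; rewrite jE !eqxx.
have [->|ne_ij'] := eqVneq i j'; first exact: adjM.
have ne_ij : i != j by rewrite -val_eqE /= ltn_eqF.
have -> : tperm i j = tperm i j' ^ tperm j' j.
  by rewrite tpermJ tpermL tpermD // eq_sym.
rewrite groupJ // IHk //.
by move: le_jik; rewrite jE subSn.
Qed.

Lemma reach_in_ex n (s t : 'S_n) : exists k, reach_in s t k.
Proof.
have : t * s^-1 \in <<adj_tperms n>>.
  have [ts -> _] := prod_tpermP (t * s^-1).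
  by apply: group_prod => ij _; apply: tperm_in_adj_gen.
case/gen_prodgP => k [c Ac def_ts].
have -> : t = (\prod_(i < k) c i) * s by rewrite -def_ts mulgKV.
exists k; elim: k c Ac {def_ts} s => [|k IHk] c Ac s.
  by apply/existsP; exists [tuple]; rewrite big_ord0 mul1g /=.
have /existsP[p /andP[pp /eqP lp]] :=
  IHk (fun i => c (widen_ord (leqnSn k) i)) (fun i => Ac _) (c ord_max * s).
apply/existsP; exists [tuple of (c ord_max * s) :: p].
rewrite /= pp andbT lp big_ord_recr /= mulgA eqxx andbT.
have := Ac ord_max; rewrite inE => /existsP[i /existsP[j /andP[ij /eqP cE]]].
by apply/existsP; exists i; apply/existsP; exists j; rewrite ij cE eqxx.
Qed.

Definition kendall_tau n (s t : 'S_n) : nat := ex_minn (reach_in_ex s t).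

Definition is_PA n (d : nat) (A : {set 'S_n}) : bool :=
  [forall s in A, forall t in A, (s != t) ==> (d <= kendall_tau s t)].

Definition PA_max (n d : nat) : nat := \max_(A : {set 'S_n} | is_PA d A) #|A|.

Definition S_set (n m : nat) : {set 'S_n} :=
  [set s : 'S_n | [forall a : 'I_n, forall b : 'I_n,
     (a < b < n - m) ==> (s^-1 a < s^-1 b)]].

Definition is_array n (m d : nat) (A : {set 'S_n}) : bool :=
  (A \subset S_set n m) && is_PA d A.

Definition array_max (n m d : nat) : nat :=
  \max_(A : {set 'S_n} | is_array m d A) #|A|.

(* Main.v *)
(** An (n-m, d)-PA acts on an (n, m, d)-array by relabelling the n - m smallest
    symbols: the pair (s, p) gives the string s * p, where p fixes the m largest
    symbols.  Relabelling is an isometry, so two strings with the same p are as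
    far apart as their array components.  Erasing the m largest symbols turns an
    adjacent swap into an adjacent swap or into nothing, hence does not increase
    distances, and it sends s * p to p; so two strings with different p are at
    least as far apart as these p. *)
Require Import Defs.
From mathcomp Require Import all_boot all_fingroup.

Set Implicit Arguments.
Unset Strict Implicit.
Unset Printing Implicit Defensive.

Local Open Scope group_scope.

Lemma reach_in0 n (s : 'S_n) : reach_in s s 0.
Proof. by apply/existsP; exists [tuple]; rewrite /= eqxx. Qed.

Lemma reach_inS n (s u t : 'S_n) k :
  adj_swap s u -> reach_in u t k -> reach_in s t k.+1.
Proof.
move=> su /existsP[p /andP[up lp]].
by apply/existsP; exists [tuple of u :: p]; rewrite /= su up.
Qed.

(** Apply [f] along a shortest swap path and drop the steps that become stationary: the image path
    is no longer than the original. *)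
Lemma kendall_tau_contract n k (f : 'S_n -> 'S_k) :
    (forall s t, adj_swap s t -> f s = f t \/ adj_swap (f s) (f t)) ->
  forall s t, kendall_tau (f s) (f t) <= kendall_tau s t.
Proof.
move=> f_step s t; rewrite {2}/kendall_tau.
case: ex_minnP => l /existsP[p /andP[sp /eqP lp]] _.
have [l' le_l'l reach_l'] : exists2 l', l' <= l & reach_in (f s) (f t) l'.
  case: p sp lp => p /= /eqP <-.
  elim: p s => [|u p IHp] s /= => [_ ->|/andP[su up] lp].
    by exists 0; rewrite ?reach_in0.
  have [l' le_l' reach_l'] := IHp u up lp.
  have [->|fsu] := f_step s u su; first by exists l'; rewrite // leqW.
  by exists l'.+1 => //; apply: reach_inS reach_l'.
apply: leq_trans le_l'l; rewrite /kendall_tau.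
by case: ex_minnP => l0 _; apply.
Qed.

(** Swaps act on positions, by left multiplication, so they commute with the relabelling
    [v => v * u^-1], which is therefore a contraction. *)
Lemma kendall_tau_mulr n (u s t : 'S_n) :
  kendall_tau s t <= kendall_tau (s * u) (t * u).
Proof.
rewrite -{1}(mulgK u s) -{1}(mulgK u t).
apply: (kendall_tau_contract (f := fun v => v * u^-1)) => {}s {}t.
case/existsP=> i /existsP[j /andP[ij /eqP ->]].
right; apply/existsP; exists i; apply/existsP; exists j.
by rewrite ij mulgA eqxx.
Qed.

(** No value lies strictly between [i] and [i.+1], so exchanging them reverses the order of that one
    pair only. *)
Lemma tperm_adj_ltn n (i j x y : 'I_n) : nat_of_ord j = i.+1 ->
    ~~ ((x == i) && (y == j)) -> ~~ ((x == j) && (y == i)) ->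
  (tperm i j x < tperm i j y) = (x < y).
Proof.
move=> ij; case: tpermP => [->|->|/eqP xi /eqP xj];
  case: tpermP => [->|->|/eqP yi /eqP yj]; rewrite ?eqxx ?ltnn //= => _ _.
- by rewrite ij ltn_neqAle eq_sym -ij yj.
- by rewrite ij [RHS]ltn_neqAle eq_sym -ij yj.
- by rewrite ij ltnS [LHS]leq_eqVlt (inj_eq val_inj) (negbTE xi).
- by rewrite ij ltnS [RHS]leq_eqVlt (inj_eq val_inj) (negbTE xi).
Qed.

Section Erasure.

Variables (n k : nat) (le_kn : k <= n).
Implicit Types (s : 'S_n) (p : 'S_k) (a b : 'I_k).

Local Notation w := (widen_ord le_kn).

Lemma widen_inj : injective w.
Proof. by move=> a b /(congr1 val) /= /val_inj. Qed.

Definition relabel_fun p (x : 'I_n) : 'I_n :=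
  if insub (val x) is Some a then w (p a) else x.

Lemma relabel_fun_widen p a : relabel_fun p (w a) = w (p a).
Proof. by rewrite /relabel_fun valK. Qed.

Lemma relabel_inj p : injective (relabel_fun p).
Proof.
apply: (can_inj (g := relabel_fun p^-1)) => x.
rewrite {2}/relabel_fun; case: insubP => [a _ ax|x_ge].
  by rewrite relabel_fun_widen permK; apply: val_inj.
by rewrite /relabel_fun insubN.
Qed.

Definition relabel p : 'S_n := perm (@relabel_inj p).

Lemma relabel_widen p a : relabel p (w a) = w (p a).
Proof. by rewrite permE relabel_fun_widen. Qed.

Definition before s a : {set 'I_k} := [set b | s^-1 (w b) < s^-1 (w a)].

Lemma before_lt s a : #|before s a| < k.
Proof.
rewrite -[X in _ < X]card_ord -cardsT; apply: proper_card; rewrite properT.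
by apply/eqP => /setP/(_ a); rewrite !inE ltnn.
Qed.

Definition erased_pos s a : 'I_k := Ordinal (before_lt s a).

Lemma erased_pos_inj s : injective (erased_pos s).
Proof.
have mono a b : s^-1 (w a) < s^-1 (w b) -> #|before s a| < #|before s b|.
  move=> ab; apply: proper_card; apply/properP; split.
    by apply/subsetP => c; rewrite !inE => /ltn_trans; apply.
  by exists a; rewrite inE // ltnn.
move=> a b /(congr1 val) /= eq_ab.
case: (ltngtP (s^-1 (w a)) (s^-1 (w b))) => [/mono|/mono|].
- by rewrite eq_ab ltnn.
- by rewrite eq_ab ltnn.
by move/val_inj/perm_inj/widen_inj.
Qed.

(** Inverted because [erased_pos s] sends symbols to positions, whereas a string sends positions to
    symbols. *)
Definition erase s : 'S_k := (perm (@erased_pos_inj s))^-1.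

Lemma eraseV s a : (erase s)^-1 a = erased_pos s a.
Proof. by rewrite invgK permE. Qed.

(** The small symbols preceding [a] in [s * u] are the images under [p] of those preceding [p^-1 a]
    in [s], so both sets have the same size. *)
Lemma erase_mulr s (u : 'S_n) p :
  (forall a, u (w a) = w (p a)) -> erase (s * u) = erase s * p.
Proof.
move=> up; have uV a : u^-1 (w a) = w (p^-1 a).
  by apply: (canLR (permK u)); rewrite up permKV.
apply: invg_inj; apply/permP => a; rewrite invMg permM !eraseV.
apply: val_inj => /=; rewrite -[RHS](card_imset _ (@perm_inj _ p)).
congr #|pred_of_set _|; apply/setP => b.
by rewrite -{2}(permKV p b) mem_imset ?inE ?invMg ?permM ?uV //; apply: perm_inj.
Qed.

Lemma erase_relabel s p : erase (s * relabel p) = erase s * p.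
Proof. exact/erase_mulr/relabel_widen. Qed.

Lemma erase_increasing s :
  (forall a b, a < b -> s^-1 (w a) < s^-1 (w b)) -> erase s = 1.
Proof.
move=> s_inc; apply: invg_inj; apply/permP => a.
rewrite eraseV invg1 perm1; apply: val_inj => /=.
have -> : before s a = [set b : 'I_k | b < a].
  apply/setP => b; rewrite !inE; case: (ltngtP b a) => [/s_inc //|/s_inc|].
    by move=> ab; apply/negbTE; rewrite -leqNgt ltnW.
  by move/val_inj ->; rewrite ltnn.
rewrite -sum1dep_card (big_ord_narrow (ltnW (ltn_ord a))).
by rewrite sum1_card card_ord.
Qed.

(** If both exchanged symbols are small, they stay adjacent after erasure; otherwise the relative
    order of the small symbols is unchanged. *)
Lemma erase_adj_swap s t :
  adj_swap s t -> erase s = erase t \/ adj_swap (erase s) (erase t).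
Proof.
case/existsP=> i /existsP[j /andP[/eqP ij /eqP ->]].
have tV a : (tperm i j * s)^-1 (w a) = tperm i j (s^-1 (w a)).
  by rewrite invMg tpermV permM.
case: (pickP [pred ab | (s^-1 (w ab.1) == i) && (s^-1 (w ab.2) == j)]) => /=.
  case=> a b /= /andP[/eqP ai /eqP bj]; right.
  (* By conjugation, exchanging two positions is exchanging the symbols they hold, a relabelling to
     which [erase_mulr] applies. *)
  have -> : tperm i j * s = s * tperm (w a) (w b).
    by rewrite -ai -bj -tpermJ -conjgCV.
  rewrite (erase_mulr _ (p := tperm a b)) => [|c]; last first.
    by rewrite (inj_tperm _ _ _ widen_inj).
  apply/existsP; exists (erased_pos s a); apply/existsP; exists (erased_pos s b).
  rewrite -!eraseV -tpermJ -conjgCV eqxx andbT !eraseV /=.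
  (* As [b] comes right after [a] in [s], only [a] is added, so the erased positions differ by
     exactly one. *)
  suff -> : before s b = a |: before s a by rewrite cardsU1 inE ltnn.
  apply/setP => c; rewrite !inE ai bj ij ltnS leq_eqVlt; congr orb.
  by rewrite -ai (inj_eq val_inj) (inj_eq perm_inj) (inj_eq widen_inj).
move=> none; left; apply: invg_inj; apply/permP => a; rewrite !eraseV.
apply: val_inj => /=; congr #|pred_of_set _|; apply/setP => b.
rewrite !inE !tV tperm_adj_ltn //.
  by have /= -> := none (b, a).
(* [none] covers ordered pairs, so each orientation is excluded by its own instance. *)
by rewrite andbC; have /= -> := none (a, b).
Qed.

End Erasure.

Lemma PA_max_ge n d (A : {set 'S_n}) : is_PA d A -> #|A| <= PA_max n d.
Proof. exact: leq_bigmax_cond. Qed.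

Lemma is_PA0 n d : is_PA d (set0 : {set 'S_n}).
Proof. by apply/forall_inP => s; rewrite inE. Qed.

Lemma PA_max_attained n d : exists2 A : {set 'S_n}, is_PA d A & #|A| = PA_max n d.
Proof.
have [|A dA maxA] := @eq_bigmax_cond _ (@is_PA n d) (fun A => #|A|).
  by apply/card_gt0P; exists set0; apply: is_PA0.
by exists A => //; apply: esym maxA.
Qed.

Lemma array_max_attained n m d :
  exists2 A : {set 'S_n}, is_array m d A & #|A| = array_max n m d.
Proof.
have [|A dA maxA] := @eq_bigmax_cond _ (@is_array n m d) (fun A => #|A|).
  by apply/card_gt0P; exists set0; apply/andP; rewrite sub0set is_PA0.
by exists A => //; apply: esym maxA.
Qed.

Local Close Scope group_scope.

Theorem theorem6 (n m d : nat) (n_gt0 : 0 < n) (m_gt0 : 0 < m) (d_gt0 : 0 < d)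
    (lt_mn : m < n) :
  PA_max n d >= array_max n m d * PA_max (n - m) d.
Proof.
have [A /andP[/subsetP AS dA] <-] := array_max_attained n m d.
have [B dB <-] := PA_max_attained (n - m) d.
have le_kn : n - m <= n := leq_subr m n.
pose f (sp : 'S_n * 'S_(n - m)) := (sp.1 * relabel le_kn sp.2)%g.
(* Members of [A] have their small symbols in increasing order, so they erase to the identity and
   only [p] remains. *)
have erase_f s p : s \in A -> erase le_kn (f (s, p)) = p.
  move=> /AS; rewrite inE => /forallP s_inc.
  rewrite erase_relabel erase_increasing ?mul1g // => a b ab.
  have /forallP/(_ (widen_ord le_kn b))/implyP := s_inc (widen_ord le_kn a).
  by apply; rewrite /= ab ltn_ord.
(* Erasure recovers the second component; cancelling its relabelling recovers the first. *)
have f_inj : {in setX A B &, injective f}.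
  move=> [s p] [t q] /setXP[sA _] /setXP[tA _] eq_f.
  have eq_pq : p = q by rewrite -(erase_f s p sA) eq_f erase_f.
  by move: eq_f; rewrite /f /= eq_pq => /mulIg ->.
rewrite -cardsX -(card_in_imset f_inj); apply: PA_max_ge.
apply/forall_inP => _ /imsetP[[s p] /setXP[sA pB] ->].
apply/forall_inP => _ /imsetP[[t q] /setXP[tA qB] ->].
apply/implyP => ne_f; have [eq_pq|ne_pq] := eqVneq p q.
  have ne_st : s != t by apply: contraNneq ne_f => ->; rewrite eq_pq.
  have /forall_inP/(_ s sA)/forall_inP/(_ t tA)/implyP/(_ ne_st) := dA.
  by rewrite -eq_pq => /leq_trans; apply; apply: kendall_tau_mulr.
have /forall_inP/(_ p pB)/forall_inP/(_ q qB)/implyP/(_ ne_pq) := dB.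
move/leq_trans; apply; rewrite -{1}(erase_f s p sA) -{1}(erase_f t q tA).
exact/kendall_tau_contract/erase_adj_swap.
Qed.
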